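(* Let $D$ be a division ring, and let $A$ be a finite non-empty subset of $D$ such that $|A+A| \leq K|A|$ and $|A \cdot A| \leq K|A|$ for some $K \geq 1$. Then there exists a finite subring $S$ of $D$ of cardinality $|S| \ll K^{O(1)} |A|$ and an invertible element $a \in A$ such that $a \cdot S = S \cdot a$ and $A \subset a \cdot S + \mathbf{O}( K^{O(1)} )$.
   Context: A division ring is a ring with identity, not necessarily commutative, in which every non-zero element is invertible. Rings are not required to be commutative or to contain a multiplicative identity; accordingly a subring is an additive subgroup closed under multiplication (it is not required to contain the identity). For subsets $A,B$ of a ring: $A+B := \{a+b : a\in A, b\in B\}$, $A\cdot B := \{ab : a\in A, b\in B\}$; $r\cdot A := \{ra : a\in A\}$ and $A\cdot r := \{ar : a \in A\}$ for a ring element $r$. $|A|$ denotes the cardinality of a finite set $A$. $X \ll Y$ means $X \leq CY$ for some absolute constant $C$; $O(1)$ denotes a quantity bounded by an absolute constant. $\mathbf{O}(N)$ denotes an unspecified finite non-empty subset of the ring of cardinality $O(N)$; thus $A \subset a\cdot S + \mathbf{O}(K^{O(1)})$ means that there is a finite non-empty set $X$ in the ring with $|X| = O(K^{O(1)})$ such that $A \subset a\cdot S + X$. All implied constants are absolute (independent of $D$, $A$, $K$).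
   Formalization: The set A = {0} is excluded: it satisfies |A+A| ≤ K|A| and |A·A| ≤ K|A| with K = 1 but contains no invertible element a, so the claim as printed fails for it; nothing else is changed. *)

(* Defs.v *)
From mathcomp Require Import all_boot all_order all_algebra.
From mathcomp Require Export finmap.
From mathcomp Require Export reals.

Set Implicit Arguments.
Unset Strict Implicit.
Unset Printing Implicit Defensive.

Import GRing.Theory.

Local Open Scope fset_scope.
Local Open Scope ring_scope.

(* A unitRingType is a possibly noncommutative ring with 1 <> 0, in which
   GRing.unit is the set of two-sided invertible elements. *)
Definition division_ring (D : unitRingType) : Prop :=
  forall x : D, x != 0 -> x \is a GRing.unit.

Section Pointwise.
Variable D : nzRingType.
Implicit Types (A B S : {fset D}) (r : D).

Definition sumset A B : {fset D} := [fset a + b | a in A, b in B].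
Definition prodset A B : {fset D} := [fset a * b | a in A, b in B].
Definition ldilate r A : {fset D} := [fset r * a | a in A].
Definition rdilate A r : {fset D} := [fset a * r | a in A].

(* Rings need not be unital, so 1 \in S is not required, in contrast with
   subring_closed. *)
Definition finite_subring S : Prop :=
  GRing.zmod_closed [in S] /\ GRing.mulr_2closed [in S].

End Pointwise.

(* Main.v *)
(* Discard 0 from A.  Cauchy-Schwarz on the collisions a b = a' b', used once on
   each side, produces a large B in A such that b B - b' B and B b - B b' have
   size O(K^O(1)) |B| for all b, b' in B.  Put V = B - B.  Sumset calculus
   (Petridis, Ruzsa) then gives
     x = u^-1 v  ==>  |B - x B| << |B|  and  x = v u^-1  ==>  |B - B x| << |B|
   for u, v in V.  Conversely |B - x B| < |B|^2 forces a collision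
   b - x b' = c - x c', so x is some v u^-1; likewise |B - B x| < |B|^2 forces x to
   be some u^-1 v.  Hence, once |B| exceeds a fixed power of K, the set S of
   left quotients equals the set of right quotients and is
   { x : |B - x B| <= T |B| } for a whole range of thresholds T, which makes it a
   ring.  It contains b^-1 b', so B lies in a S for a in B, and writing
   s = v u^-1 with u, v in a S shows S a = a S.  If |B| is small, S = {0} and X = A
   do. *)
Require Import Defs.
From mathcomp Require Import all_boot all_order all_algebra.
From mathcomp Require Import finmap reals.
From mathcomp Require Import zify.

Set Implicit Arguments.
Unset Strict Implicit.
Unset Printing Implicit Defensive.

Import Order.TTheory GRing.Theory Num.Theory.

Local Open Scope fset_scope.
Local Open Scope ring_scope.

Section FiniteSets.
Variables (T U : choiceType).

Lemma cardfsM (A : {fset T}) (B : {fset U}) :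
  #|` A `*` B| = (#|` A| * #|` B|)%N.
Proof.
rewrite (perm_size (enum_imfset2 _ _)) ?size_allpairs//.
by move=> [a b] [c d] _ _ /= [-> ->].
Qed.

Lemma leq_card_in_imfset (X : {fset T}) (Y : {fset U}) (f : T -> U) :
  {in X &, injective f} -> {in X, forall x, f x \in Y} -> (#|` X| <= #|` Y|)%N.
Proof.
move=> f_inj fXY.
rewrite -(card_in_imfset imfset_key f_inj); apply: fsubset_leq_card.
by apply/fsubsetP => _ /imfsetP[x xX ->]; apply: fXY.
Qed.

Lemma collision (X : {fset T}) (Y : {fset U}) (f : T -> U) :
  {in X, forall x, f x \in Y} -> (#|` Y| < #|` X|)%N ->
  exists x x', [/\ x \in X, x' \in X, x != x' & f x = f x'].
Proof.
move=> fXY ltYX.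
case: (boolP (has (fun x => has (fun x' => (x != x') && (f x == f x')) X) X)).
  move=> /hasP[x xX /hasP[x' x'X /andP[nexx' /eqP fxx']]].
  by exists x, x'.
move=> /hasPn noc; move: ltYX; rewrite ltnNge => /negP[].
apply: (leq_card_in_imfset (f := f)) => // x x' xX x'X fxx'; apply/eqP.
by have /hasPn/(_ _ x'X) := noc x xX; rewrite fxx' eqxx andbT negbK.
Qed.

End FiniteSets.

Lemma sum_leq_argmax (T : eqType) (s : seq T) (F : T -> nat) (m : nat) :
  (0 < size s)%N -> (m <= \sum_(x <- s) F x)%N ->
  exists2 x, x \in s & (m <= size s * F x)%N.
Proof.
move=> s_gt0 lem.
case: (boolP (has (fun x => m <= size s * F x)%N s)) => [/hasP//|/hasPn noF].
have : (\sum_(x <- s) (size s * F x).+1 <= \sum_(x <- s) m)%N.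
  by rewrite big_seq [leqRHS]big_seq; apply: leq_sum => x /noF; rewrite -ltnNge.
under eq_bigr do rewrite -addn1.
rewrite big_split /= -big_distrr /= sum1_size big_const_seq count_predT iter_addn_0.
by rewrite (mulnC m) => le; have := leq_mul (leqnn (size s)) lem; lia.
Qed.

Lemma leq_sqr_sum (T : Type) (s : seq T) (F : T -> nat) :
  ((\sum_(x <- s) F x) ^ 2 <= size s * \sum_(x <- s) F x ^ 2)%N.
Proof.
rewrite -(leq_pmul2l (ltn0Sn 1)) -mulnn big_distrlr /=.
rewrite big_distrr /=; under eq_bigr do rewrite big_distrr /=.
apply: (@leq_trans (\sum_(i <- s) \sum_(j <- s) (F i ^ 2 + F j ^ 2))).
  by apply: leq_sum => i _; apply: leq_sum => j _; apply: (nat_Cauchy (F i) (F j)).1.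
under eq_bigr do rewrite big_split /= big_const_seq count_predT iter_addn_0.
rewrite big_split /= -big_distrl /= big_const_seq count_predT iter_addn_0.
by rewrite mulnC; lia.
Qed.

Lemma sqr_size_leq_collisions (T U : eqType) (s : seq T) (t : seq U) (f : T -> U) :
  uniq t -> {in s, forall x, f x \in t} ->
  (size s ^ 2 <= size t * \sum_(x <- s) \sum_(x' <- s) (f x == f x'))%N.
Proof.
move=> t_uniq fst.
have sum1t x : x \in s -> \sum_(y <- t) (f x == y : nat)%N = 1%N.
  move=> xs; rewrite -big_mkcond /= (eq_bigl (pred1 (f x))) ?sum1_count.
    by rewrite count_uniq_mem// fst.
  by move=> y /=; rewrite eq_sym.
have -> : size s = (\sum_(y <- t) \sum_(x <- s) (f x == y))%N.
  rewrite exchange_big /= -sum1_size big_seq [RHS]big_seq.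
  by apply: eq_bigr => x /sum1t ->.
apply: (leq_trans (leq_sqr_sum _ _)); rewrite leq_mul2l; apply/orP; right.
under eq_bigr do rewrite -mulnn big_distrlr /=.
rewrite exchange_big /=; apply: leq_sum => x _.
rewrite exchange_big /=; apply: leq_sum => x' _.
case: eqP => [->|/eqP nefx].
  have [x's|] := boolP (f x' \in t).
    rewrite (eq_bigr (fun y => (f x' == y) : nat)) => [|y _]; last by case: eqP.
    rewrite -big_mkcond /= (eq_bigl (pred1 (f x'))) ?sum1_count.
      by rewrite count_uniq_mem// leq_b1.
    by move=> y /=; rewrite eq_sym.
  move=> nt; rewrite big_seq big1// => y yt.
  by case: eqP => // yx; rewrite yx yt in nt.
rewrite big1// => y _; case: eqP => [<-|_] //.
by rewrite eq_sym (negbTE nefx).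
Qed.
Section SumsetCalculus.
Variable D : nzRingType.
Implicit Types (A B C X Y Z : {fset D}) (x y z : D).

Definition oppset A : {fset D} := [fset - a | a in A].
Definition diffset A B : {fset D} := sumset A (oppset B).
Definition nsumset n A : {fset D} := iter n (sumset A) [fset 0].

Lemma sumsetP A B x :
  reflect (exists a b, [/\ a \in A, b \in B & x = a + b]) (x \in sumset A B).
Proof.
apply: (iffP (imfset2P _ _ _ _ _)) => [[a aA [b bB ->]]|[a [b [aA bB ->]]]].
  by exists a, b.
by exists a => //; exists b.
Qed.

Lemma mem_sumset A B a b : a \in A -> b \in B -> a + b \in sumset A B.
Proof. by move=> aA bB; apply/sumsetP; exists a, b. Qed.

Lemma mem_oppset A x : (- x \in oppset A) = (x \in A).
Proof.
apply/imfsetP/idP => [[y /= yA /oppr_inj ->]//|xA]; by exists x.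
Qed.

Lemma mem_diffset A B a b : a \in A -> b \in B -> a - b \in diffset A B.
Proof. by move=> aA bB; rewrite mem_sumset// mem_oppset. Qed.

Lemma diffsetP A B x :
  reflect (exists a b, [/\ a \in A, b \in B & x = a - b]) (x \in diffset A B).
Proof.
apply: (iffP idP) => [/sumsetP[a [_ [aA /imfsetP[b /= bB ->] ->]]]|].
  by exists a, b.
by move=> [a [b [aA bB ->]]]; apply: mem_diffset.
Qed.

Lemma sumsetC A B : sumset A B = sumset B A.
Proof.
by apply/fsetP => x; apply/sumsetP/sumsetP => -[a [b [? ? ->]]];
  exists b, a; rewrite addrC.
Qed.

Lemma sumsetA A B C : sumset A (sumset B C) = sumset (sumset A B) C.
Proof.
apply/fsetP => x; apply/sumsetP/sumsetP.
  move=> [a [_ [aA /sumsetP[b [c [bB cC ->]]] ->]]]; exists (a + b), c.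
  by rewrite addrA; split => //; apply: mem_sumset.
move=> [_ [c [/sumsetP[a [b [aA bB ->]]] cC ->]]]; exists a, (b + c).
by rewrite addrA; split => //; apply: mem_sumset.
Qed.

Lemma sumset0l A : sumset [fset 0] A = A.
Proof.
apply/fsetP => x; apply/sumsetP/idP => [[_ [b [/fset1P -> bA ->]]]|xA].
  by rewrite add0r.
by exists 0, x; rewrite add0r inE.
Qed.

Lemma sumsetACA A B C X :
  sumset (sumset A B) (sumset C X) = sumset (sumset A C) (sumset B X).
Proof. by rewrite -!sumsetA; congr sumset; rewrite !sumsetA (sumsetC B). Qed.

Lemma oppset_sumset A B : oppset (sumset A B) = sumset (oppset A) (oppset B).
Proof.
apply/fsetP => x; apply/imfsetP/sumsetP.
  move=> [_ /= /sumsetP[a [b [aA bB ->]]] ->]; exists (- a), (- b).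
  by rewrite !mem_oppset opprD.
move=> [_ [_ [/imfsetP[a /= aA ->] /imfsetP[b /= bB ->] ->]]].
by exists (a + b); rewrite ?mem_sumset// opprD.
Qed.

Lemma oppsetK A : oppset (oppset A) = A.
Proof. by apply/fsetP => x; rewrite -{1}(opprK x) !mem_oppset. Qed.

Lemma card_oppset A : #|` oppset A| = #|` A|.
Proof. by rewrite card_imfset//=; apply: oppr_inj. Qed.

Lemma card_diffsetC A B : #|` diffset A B| = #|` diffset B A|.
Proof. by rewrite -card_oppset oppset_sumset oppsetK sumsetC. Qed.

Lemma sumsetS A B A' B' : A `<=` A' -> B `<=` B' -> sumset A B `<=` sumset A' B'.
Proof.
move=> /fsubsetP AA' /fsubsetP BB'; apply/fsubsetP => _ /sumsetP[a [b [aA bB ->]]].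
by rewrite mem_sumset ?AA' ?BB'.
Qed.

Lemma oppsetS A B : A `<=` B -> oppset A `<=` oppset B.
Proof.
by move=> /fsubsetP AB; apply/fsubsetP => _ /imfsetP[a /= /AB aB ->]; rewrite mem_oppset.
Qed.

Lemma diffsetS A B A' B' : A `<=` A' -> B `<=` B' -> diffset A B `<=` diffset A' B'.
Proof. by move=> AA' /oppsetS; apply: sumsetS. Qed.

Lemma card_sumset_leq A B : (#|` sumset A B| <= #|` A| * #|` B|)%N.
Proof.
rewrite -cardfsM.
apply: (@leq_trans #|` [fset u.1 + u.2 | u in A `*` B]|); last first.
  exact: leq_imfset_card.
apply: fsubset_leq_card; apply/fsubsetP => _ /sumsetP[a [b [aA bB ->]]].
by apply/imfsetP; exists (a, b) => //=; rewrite in_fsetM aA.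
Qed.

Lemma leq_card_sumsetr A B : A != fset0 -> (#|` B| <= #|` sumset A B|)%N.
Proof.
move=> /fset0Pn[a aA]; apply: (leq_card_in_imfset (f := +%R a)).
  by move=> ? ? _ _; apply: addrI.
by move=> b bB; apply: mem_sumset.
Qed.

Lemma card_sumset1 A c : #|` sumset A [fset c]| = #|` A|.
Proof.
apply/eqP; rewrite eqn_leq; apply/andP; split.
  by apply: leq_trans (card_sumset_leq _ _) _; rewrite cardfs1 muln1.
by rewrite sumsetC leq_card_sumsetr//; apply/fset0Pn; exists c; rewrite inE.
Qed.

Lemma sumsetUr A B C : sumset A (B `|` C) = sumset A B `|` sumset A C.
Proof.
apply/fsetP => x; rewrite inE; apply/sumsetP/orP.
  move=> [a [b [aA + ->]]]; rewrite inE => /orP[bB|bC].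
    by left; apply: mem_sumset.
  by right; apply: mem_sumset.
move=> [/sumsetP[a [b [aA bB ->]]]|/sumsetP[a [b [aA bB ->]]]]; exists a, b.
  by rewrite inE bB.
by rewrite inE bB orbT.
Qed.

(* Each difference d in X - Z has a chosen representation x - z, and
   (d, y) |-> (x - y, y - z) is injective. *)
Lemma ruzsa_triangle X Y Z :
  (#|` diffset X Z| * #|` Y| <= #|` diffset X Y| * #|` diffset Y Z|)%N.
Proof.
pose s := [seq (x, z) | x <- X, z <- Z].
pose rep d := nth (0, 0) s (find (fun p => p.1 - p.2 == d) s).
have repP d : d \in diffset X Z ->
    [/\ (rep d).1 \in X, (rep d).2 \in Z & (rep d).1 - (rep d).2 = d].
  move=> /diffsetP[x [z [xX zZ ->]]].
  have hs : has (fun p => p.1 - p.2 == x - z) s.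
    by apply/hasP; exists (x, z); rewrite //= allpairs_f.
  have /allpairsP[[x' z'] [/= ? ? e]] : rep (x - z) \in s by rewrite mem_nth// -has_find.
  by split; [rewrite e | rewrite e | apply/eqP; apply: (nth_find (0, 0) hs)].
rewrite -!cardfsM.
apply: (leq_card_in_imfset (f := fun p => ((rep p.1).1 - p.2, p.2 - (rep p.1).2))).
  move=> [d y] [d' y']; rewrite !in_fsetM /= => /andP[dXZ _] /andP[d'XZ _] [e1 e2].
  have ed : d = d'.
    have [_ _ ed] := repP _ dXZ; have [_ _ ed'] := repP _ d'XZ.
    apply: etrans (esym ed) (etrans _ ed').
    by rewrite -(subrKA y) e1 e2 subrKA.
  by move: e1; rewrite -ed => /addrI/oppr_inj ->.
move=> [d y]; rewrite !in_fsetM /= => /andP[/repP[? ? _] yY].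
by rewrite !mem_diffset.
Qed.

Lemma petridis X B C :
  (forall Z, Z `<=` X -> (#|` sumset X B| * #|` Z| <= #|` X| * #|` sumset Z B|)%N) ->
  (#|` X| * #|` sumset (sumset X B) C| <= #|` sumset X B| * #|` sumset X C|)%N.
Proof.
move=> minX; elim/fset1U_rect: C => [|c C cC IH].
  have sumset0r A : sumset A fset0 = fset0.
    by apply/fsetP => x; rewrite inE; apply/negP => /sumsetP[? [? []]].
  by rewrite !sumset0r cardfs0 !muln0.
set XB := sumset X B in minX IH *.
pose Z := [fset x in X | sumset [fset x] (sumset B [fset c]) `<=` sumset XB C].
have ZX : Z `<=` X by apply/fsubsetP => x; rewrite !inE => /andP[].
have hXB : (#|` sumset XB (c |` C)| + #|` sumset Z B| <= #|` sumset XB C| + #|` XB|)%N.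
  rewrite sumsetUr -(card_sumset1 XB c) -(card_sumset1 (sumset Z B) c) fsetUC.
  rewrite -[in leqRHS]cardfsUI leq_add2l; apply: fsubset_leq_card.
  rewrite fsubsetI; apply/andP; split; last first.
    by apply: sumsetS => //; apply: sumsetS.
  apply/fsubsetP => _ /sumsetP[_ [c' [/sumsetP[z [b [zZ bB ->]]] c'c ->]]].
  move: zZ; rewrite !inE => /andP[_ /fsubsetP]; apply; rewrite -addrA.
  by rewrite !mem_sumset// inE.
have hXC : (#|` sumset X C| + #|` X| <= #|` sumset X (c |` C)| + #|` Z|)%N.
  rewrite sumsetUr fsetUC -(card_sumset1 X c) -cardfsUI leq_add2l.
  apply: (leq_card_in_imfset (f := fun y => y - c)) => [? ? _ _ /addIr//|y].
  rewrite inE => /andP[yXC /sumsetP[x [c' [xX /fset1P -> ey]]]].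
  rewrite ey addrK !inE xX /=.
  apply/fsubsetP => _ /sumsetP[x' [_ [/fset1P -> /sumsetP[b [c'' [bB /fset1P -> ->]]] ->]]].
  move: yXC; rewrite ey => /sumsetP[x1 [c1 [x1X c1C e]]].
  by rewrite addrCA e addrCA addrA !mem_sumset.
have := minX _ ZX.
have := leq_mul (leqnn #|` X|) hXB; have := leq_mul (leqnn #|` XB|) hXC.
by rewrite !mulnDr (mulnC #|` XB| #|` X|); lia.
Qed.

Lemma ratio_minimiser Y B : Y != fset0 ->
  exists X, [/\ X `<=` Y, X != fset0,
    (#|` sumset X B| * #|` Y| <= #|` X| * #|` sumset Y B|)%N &
    forall Z, Z `<=` X -> (#|` sumset X B| * #|` Z| <= #|` X| * #|` sumset Z B|)%N].
Proof.
elim/finSet_rect: Y => Y IH Y0.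
have [/hasP[Z]|/hasPn minY] := boolP (has (fun Z =>
    #|` Y| * #|` sumset Z B| < #|` sumset Y B| * #|` Z|)%N (fpowerset Y)); last first.
  exists Y; split=> // [|Z]; first by rewrite mulnC.
  by rewrite -fpowersetE => /minY; rewrite -leqNgt.
rewrite fpowersetE => ZY ltZY.
have Z_gt0 : (0 < #|` Z|)%N by case: (#|` Z|) ltZY => //; rewrite muln0.
have ltZ : Z `<` Y.
  by rewrite fproperEneq ZY andbT; apply/eqP => eZ; move: ltZY; rewrite eZ mulnC ltnn.
have [|X [XZ X0 leX minX]] := IH _ ltZ; first by rewrite -cardfs_gt0.
exists X; split=> //; first exact: fsubset_trans XZ ZY.
rewrite -(leq_pmul2r Z_gt0).
have := leq_mul leX (leqnn #|` Y|); have := leq_mul (leqnn #|` X|) (ltnW ltZY).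
lia.
Qed.

Lemma nsumsetD k l A : sumset (nsumset k A) (nsumset l A) = nsumset (k + l) A.
Proof. by elim: k => [|k IH] /=; rewrite ?sumset0l// -sumsetA IH. Qed.

Lemma oppset_nsumset k A : oppset (nsumset k A) = nsumset k (oppset A).
Proof.
elim: k => [|k IH] /=; last by rewrite oppset_sumset IH.
by apply/fsetP => x; rewrite -{1}(opprK x) mem_oppset !inE oppr_eq0.
Qed.

Lemma plunnecke Y M k l : Y != fset0 -> (#|` diffset Y Y| <= M * #|` Y|)%N ->
  (#|` diffset (nsumset k Y) (nsumset l Y)| <= M ^ (k + l) * #|` Y|)%N.
Proof.
move=> Y0 leM.
have [X [XY X0 leX minX]] := ratio_minimiser (oppset Y) Y0.
have Y_gt0 : (0 < #|` Y|)%N by rewrite cardfs_gt0.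
have X_gt0 : (0 < #|` X|)%N by rewrite cardfs_gt0.
have leXM : (#|` sumset X (oppset Y)| <= M * #|` X|)%N.
  rewrite -(leq_pmul2r Y_gt0) (leq_trans leX)//.
  by rewrite mulnAC mulnC leq_mul2r leM orbT.
have iterX n : (#|` diffset X (nsumset n Y)| <= M ^ n * #|` X|)%N.
  rewrite /diffset oppset_nsumset; elim: n => [|n IH] /=.
    by rewrite sumsetC sumset0l mul1n.
  rewrite sumsetA -(leq_pmul2l X_gt0) (leq_trans (petridis _ minX))//.
  rewrite (leq_trans (leq_mul leXM IH))// expnS.
  by rewrite mulnACA [leqRHS]mulnCA.
rewrite -(leq_pmul2r X_gt0) (leq_trans (ruzsa_triangle _ _ _))//.
rewrite (card_diffsetC _ X) (leq_trans (leq_mul (iterX k) (iterX l)))//.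
by rewrite mulnACA -expnD -mulnA !leq_mul// fsubset_leq_card.
Qed.

Lemma ruzsa_covering Y Z M : Z != fset0 -> (#|` diffset Y Z| <= M * #|` Z|)%N ->
  exists X, [/\ X `<=` Y, (#|` X| <= M)%N & Y `<=` sumset X (diffset Z Z)].
Proof.
move=> Z0 leM; have Z_gt0 : (0 < #|` Z|)%N by rewrite cardfs_gt0.
suff [X [XY cX YX]] : exists X, [/\ X `<=` Y,
    (#|` X| * #|` Z| <= #|` diffset X Z|)%N & Y `<=` sumset X (diffset Z Z)].
  exists X; split=> //; rewrite -(leq_pmul2r Z_gt0) (leq_trans cX)//.
  by apply: leq_trans leM; apply: fsubset_leq_card; apply: diffsetS.
elim/fset1U_rect: Y {leM} => [|y Y _ [X [XY cX YX]]].
  by exists fset0; rewrite fsub0set cardfs0 mul0n.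
have [yX|yX] := boolP (y \in sumset X (diffset Z Z)).
  exists X; split=> //; first by rewrite fsubsetU// XY orbT.
  by apply/fsubsetP => x /fset1UP[->//|]; apply: (fsubsetP YX).
exists (y |` X); split.
- by apply: fsetUS.
- have disj : diffset [fset y] Z `&` diffset X Z = fset0.
    apply/fsetP => u; rewrite !inE; apply/negP => /andP[].
    move=> /diffsetP[_ [z [/fset1P -> zZ ->]]] /diffsetP[x [z' [xX z'Z e]]].
    move/negP: yX; apply; rewrite -(subrK z y) e -addrA.
    by rewrite mem_sumset// addrC mem_diffset.
  have -> : diffset (y |` X) Z = diffset [fset y] Z `|` diffset X Z.
    by rewrite /diffset ![sumset _ (oppset Z)]sumsetC sumsetUr.
  rewrite [leqRHS]cardfsU disj cardfs0 subn0 {1}/diffset sumsetC card_sumset1 card_oppset.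
  rewrite cardfsU1 mulnDl leq_add//.
  by case: (y \notin X); rewrite ?mul1n.
- apply/fsubsetP => x /fset1UP[->|xY].
    have /fset0Pn[z zZ] := Z0.
    by rewrite -{1}[y]addr0 -(subrr z) mem_sumset ?fset1U1// mem_diffset.
  apply: (fsubsetP (sumsetS _ (fsubset_refl _))) (fsubsetP YX _ xY).
  exact: fsubsetUr.
Qed.

Definition coverable M Y k Z := exists X,
  (#|` X| <= M ^ k)%N /\ Z `<=` sumset X (diffset (nsumset k Y) (nsumset k Y)).

Lemma coverable1 M Y Z : Y != fset0 -> (#|` diffset Z Y| <= M * #|` Y|)%N ->
  coverable M Y 1 Z.
Proof.
move=> Y0 /(ruzsa_covering Y0)[X [_ cX ZX]]; exists X; rewrite expn1; split=> //.
by rewrite /= [sumset Y _]sumsetC sumset0l.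
Qed.

Lemma coverableB M Y k l Z Z' : coverable M Y k Z -> coverable M Y l Z' ->
  coverable M Y (k + l) (diffset Z Z').
Proof.
move=> [X [cX ZX]] [X' [cX' ZX']]; exists (diffset X X'); split.
  rewrite expnD (leq_trans (card_sumset_leq _ _))//.
  by rewrite leq_mul// card_oppset.
apply: fsubset_trans (diffsetS ZX ZX') _.
rewrite /diffset !oppset_sumset oppsetK sumsetACA; apply: sumsetS => //.
rewrite [X in sumset _ X]sumsetC sumsetACA nsumsetD !oppset_nsumset nsumsetD.
by rewrite -oppset_nsumset.
Qed.

Lemma coverableS M Y k Z Z' : Z `<=` Z' -> coverable M Y k Z' -> coverable M Y k Z.
Proof. by move=> ZZ' [X [cX Z'X]]; exists X; split=> //; apply: fsubset_trans Z'X. Qed.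

Lemma card_coverable M Y k Z :
  Y != fset0 -> (#|` diffset Y Y| <= M * #|` Y|)%N -> coverable M Y k Z ->
  (#|` Z| <= M ^ (3 * k) * #|` Y|)%N.
Proof.
move=> Y0 leM [X [cX /fsubset_leq_card cZ]].
rewrite (leq_trans cZ)// (leq_trans (card_sumset_leq _ _))//.
rewrite (leq_trans (leq_mul cX (plunnecke k k Y0 leM)))//.
by rewrite mulnA -expnD; apply/eq_leq; congr (M ^ _ * _)%N; lia.
Qed.

Lemma card_diffset_image (f : D -> D) X Y : injective f -> {morph f : x y / x - y} ->
  #|` diffset (f @` X) (f @` Y)| = #|` diffset X Y|.
Proof.
move=> f_inj fB; have <- : #|` f @` diffset X Y| = #|` diffset X Y| by rewrite card_imfset.
congr (#|` _|); apply/fsetP => u; apply/diffsetP/imfsetP.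
  move=> [_ [_ [/imfsetP[x /= xX ->] /imfsetP[y /= yY ->] ->]]].
  by exists (x - y); rewrite ?mem_diffset ?fB.
move=> [_ /= /diffsetP[x [y [xX yY ->]]] ->]; exists (f x), (f y).
by rewrite !in_imfset ?fB.
Qed.

End SumsetCalculus.
Lemma card_fset_filter (T : choiceType) (A : {fset T}) (P : pred T) :
  #|` [fset x in A | P x]| = (\sum_(x <- A) P x)%N.
Proof. by rewrite card_fset_sum1 -big_fset_condE -big_mkcond. Qed.

Lemma popular_translates (T : choiceType) (A : {fset T}) (f : T -> T -> T) (N : nat) :
  A != fset0 -> {in A, forall a, injective (f a)} ->
  (#|` [fset f a b | a in A, b in A]| <= N * #|` A|)%N ->
  exists b (B : {fset T}), [/\ b \in A, B `<=` A, (#|` A| <= 2 * N * #|` B|)%N &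
    {in B, forall a, #|` A| <= 2 * N * #|` (f a @` A) `&` (f b @` A)|}%N].
Proof.
move=> A0 f_inj leN; have A_gt0 : (0 < #|` A|)%N by rewrite cardfs_gt0.
pose r a a' := #|` (f a' @` A) `&` (f a @` A)|.
have leE : (#|` A| ^ 3 <= \sum_(a <- A) N * \sum_(a' <- A) r a a')%N.
  pose s := [seq (a, b) | a <- A, b <- A].
  have ss : size s = (#|` A| * #|` A|)%N by rewrite size_allpairs.
  have := @sqr_size_leq_collisions _ _ s [fset f a b | a in A, b in A]
    (fun p => f p.1 p.2) (fset_uniq _).
  rewrite ss big_allpairs.
  under eq_bigr do under eq_bigr do rewrite big_allpairs /=.
  have fst : {in s, forall p, f p.1 p.2 \in [fset f a b | a in A, b in A]}.
    by move=> _ /allpairsP[[a b] [/= aA bA ->]]; rewrite in_imfset2.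
  move=> /(_ fst) le; rewrite -big_distrr /= -(leq_pmul2r A_gt0).
  apply: (@leq_trans ((#|` A| * #|` A|) ^ 2)); first by apply/eq_leq; rewrite !expnS !expn0; lia.
  apply: leq_trans le _; rewrite mulnAC leq_mul// big_seq [leqRHS]big_seq.
  apply: leq_sum => a aA; rewrite exchange_big /= big_seq [leqRHS]big_seq.
  apply: leq_sum => a' a'A.
  apply: (@leq_trans #|` [fset b in A | f a b \in f a' @` A]|).
    rewrite card_fset_filter big_seq [leqRHS]big_seq.
    apply: leq_sum => b bA; have [/imfsetP[b' /= b'A ->]|nb] := boolP (f a b \in f a' @` A).
      rewrite (eq_bigr (fun x => (x == b') : nat)) => [|x _]; last first.
        by rewrite (inj_eq (f_inj _ a'A)) eq_sym.
      by rewrite -big_mkcond /= sum1_count count_uniq_mem ?leq_b1// fset_uniq.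
    rewrite big_seq big1// => b' b'A; case: eqP => // e.
    by rewrite e in_imfset in nb.
  apply: (leq_card_in_imfset (f := f a)) => [x y _ _ /(f_inj _ aA)//|x].
  by rewrite !inE /= => /andP[xA fx]; rewrite fx in_imfset.
have [b bA leb] := sum_leq_argmax A_gt0 leE.
exists b, [fset a in A | #|` A| <= 2 * N * r b a]%N; split=> //.
- by apply/fsubsetP => x; rewrite !inE => /andP[].
- rewrite -(leq_pmul2r A_gt0).
  have {}leb : (#|` A| ^ 2 <= N * \sum_(a' <- A) r b a')%N.
    by rewrite -(leq_pmul2l A_gt0) -expnS.
  have : (\sum_(a <- A) 2 * N * r b a <= \sum_(a <- A) (#|` A| +
      2 * N * #|` A| * (#|` A| <= 2 * N * r b a)))%N.
    apply: leq_sum => a _; have [_|] := leqP #|` A| (2 * N * r b a).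
      rewrite muln1 (leq_trans _ (leq_addl _ _))// leq_mul//.
      by rewrite (leq_trans (fsubset_leq_card (fsubsetIl _ _)))// leq_imfset_card.
    by rewrite muln0 addn0 => /ltnW.
  rewrite -big_distrr big_split -big_distrr /= big_const_seq count_predT iter_addn_0.
  by rewrite card_fset_filter; move: leb; rewrite -mulnn; lia.
- by move=> a; rewrite !inE => /andP[].
Qed.

Lemma controlled_subset (D : nzRingType) (A : {fset D}) (f : D -> D -> D) (N : nat) :
  A != fset0 -> {in A, forall a, injective (f a)} ->
  (forall a, {morph f a : x y / x - y}) ->
  (#|` [fset f a b | a in A, b in A]| <= N * #|` A|)%N ->
  (#|` diffset A A| <= N * #|` A|)%N ->
  exists B : {fset D}, [/\ B `<=` A, (#|` A| <= 2 * N * #|` B|)%N &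
    {in B &, forall a a',
      #|` diffset (f a @` A) (f a' @` A)| <= (2 * N ^ 3) ^ 2 * #|` A|}%N].
Proof.
move=> A0 f_inj fB leM leD; have A_gt0 : (0 < #|` A|)%N by rewrite cardfs_gt0.
have [b [B [bA BA leB Bb]]] := popular_translates A0 f_inj leM.
exists B; split=> //.
have leb a : a \in B -> (#|` diffset (f a @` A) (f b @` A)| <= 2 * N ^ 3 * #|` A|)%N.
  move=> aB; have aA := fsubsetP BA _ aB.
  set I := (f a @` A) `&` (f b @` A).
  have leI c : c \in A -> I `<=` f c @` A ->
      (#|` diffset (f c @` A) I| <= N * #|` A|)%N /\
      (#|` diffset I (f c @` A)| <= N * #|` A|)%N.
    move=> cA Ic; split; apply: leq_trans leD;
      rewrite -(card_diffset_image A A (f_inj _ cA) (fB c)).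
      by apply: fsubset_leq_card; apply: diffsetS.
    by apply: fsubset_leq_card; apply: diffsetS.
  have [h1 _] := leI _ aA (fsubsetIl _ _).
  have [_ h2] := leI _ bA (fsubsetIr _ _).
  have := leq_trans (ruzsa_triangle _ I _) (leq_mul h1 h2).
  move: (#|` diffset _ _|) => x; have := Bb _ aB; rewrite -/I.
  move=> h3 h4; rewrite -(leq_pmul2r A_gt0).
  apply: leq_trans (leq_mul (leqnn x) h3) _.
  rewrite mulnCA; apply: leq_trans (leq_mul (leqnn _) h4) _.
  by apply/eq_leq; rewrite !expnS !expn0; lia.
move=> a a' aB a'B; rewrite -(leq_pmul2r A_gt0).
have cb : #|` f b @` A| = #|` A| by rewrite card_imfset//; apply: f_inj.
rewrite -{1}cb (leq_trans (ruzsa_triangle _ _ _))//.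
rewrite (card_diffsetC (f b @` A)) (leq_trans (leq_mul (leb _ aB) (leb _ a'B)))//.
by apply/eq_leq; rewrite mulnACA mulnn mulnA.
Qed.
Lemma sum_eq_le1 (T : eqType) (s : seq T) (y : T) (P : pred T) :
  uniq s -> (forall x, P x -> x = y) -> (\sum_(x <- s) P x <= 1)%N.
Proof.
move=> s_uniq Py; apply: (@leq_trans (\sum_(x <- s) (x == y))).
  by apply: leq_sum => x _; case: (boolP (P x)) => // /Py ->; rewrite eqxx.
by rewrite -big_mkcond /= sum1_count count_uniq_mem ?leq_b1.
Qed.

Lemma card_dilates_control (D : nzRingType) (B : {fset D}) (f : D -> D -> D) (M : nat) :
  B != fset0 -> {in B, forall b, injective (f b)} ->
  (forall b, {morph f b : x y / x - y}) ->
  (forall b, {morph f^~ b : x y / x - y}) ->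
  {in B &, forall b b', #|` diffset (f b @` B) (f b' @` B)| <= M * #|` B|}%N ->
  {in diffset B B &, forall u v,
    #|` diffset (f u @` B) (f v @` B)| <= M ^ 12 * #|` B|}%N.
Proof.
move=> /fset0Pn[c cB] f_inj fBr fBl leM.
have cc : #|` f c @` B| = #|` B| by rewrite card_imfset//; apply: f_inj.
have c0 : f c @` B != fset0 by apply/fset0Pn; exists (f c c); rewrite in_imfset.
have cov u : u \in diffset B B -> coverable M (f c @` B) 2 (f u @` B).
  move=> /diffsetP[b [b' [bB b'B ->]]].
  have covb d : d \in B -> coverable M (f c @` B) 1 (f d @` B).
    by move=> dB; apply: coverable1 => //; rewrite cc leM.
  apply: coverableS (coverableB (covb _ bB) (covb _ b'B)).
  by apply/fsubsetP => _ /imfsetP[x /= xB ->]; rewrite fBl mem_diffset ?in_imfset.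
move=> u v uV vV; rewrite -cc; apply: (@card_coverable _ _ _ 4) => //.
  by rewrite cc leM.
by apply: (coverableB (cov _ uV) (cov _ vV)).
Qed.

Lemma diffset_collision (D : nzRingType) (B : {fset D}) (g : D -> D) :
  (#|` diffset B (g @` B)| < #|` B| * #|` B|)%N ->
  exists b1 b2 b3 b4, [/\ b1 - b3 \in diffset B B, b2 - b4 \in diffset B B,
    b2 != b4 & b1 - b3 = g b2 - g b4].
Proof.
rewrite -cardfsM => /(collision (f := fun p => p.1 - g p.2)) [].
  by move=> [b b']; rewrite in_fsetM /= => /andP[bB b'B]; rewrite mem_diffset ?in_imfset.
move=> [b1 b2] [[b3 b4] []]; rewrite !in_fsetM /= => /andP[b1B b2B] /andP[b3B b4B] ne /= e.
exists b1, b2, b3, b4; rewrite !mem_diffset//; split=> //.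
  apply: contraNneq ne => e24; move: e; rewrite e24.
  by move=> /addIr ->.
by rewrite -(subrK (g b2) b1) e addrAC (addrC b3) addrK addrC.
Qed.

Section DivisionRing.
Variable D : unitRingType.
Hypothesis divD : division_ring D.
Implicit Types (A B S : {fset D}) (a b u v x y : D).

Lemma divr_mulI x : x != 0 -> injective ( *%R x).
Proof. by move=> /divD; apply: mulrI. Qed.

Lemma divr_mulIr x : x != 0 -> injective ( *%R^~ x).
Proof. by move=> /divD; apply: mulIr. Qed.

(* Double counting of the collisions b - x b' = c - x c', each nontrivial one of
   which determines x. *)
Lemma card_expanders B S T : B != fset0 -> (2 * T <= #|` B|)%N ->
  {in S, forall x, #|` diffset B (ldilate x B)| <= T * #|` B|}%N ->
  (#|` S| <= 2 * T * #|` B|)%N.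
Proof.
move=> B0 leT leS; have B_gt0 : (0 < #|` B|)%N by rewrite cardfs_gt0.
pose s := [seq (b, b') | b <- B, b' <- B].
have ss : size s = (#|` B| * #|` B|)%N by rewrite size_allpairs.
have s_uniq : uniq s by rewrite allpairs_uniq ?fset_uniq// => -[? ?] [? ?] _ _ /= [-> ->].
pose E x (p p' : D * D) := p.1 - x * p.2 == p'.1 - x * p'.2.
have leE : (\sum_(x <- S) size s ^ 2 <=
    T * #|` B| * \sum_(x <- S) \sum_(p <- s) \sum_(p' <- s) E x p p')%N.
  rewrite big_distrr big_seq [leqRHS]big_seq; apply: leq_sum => x xS.
  have h : {in s, forall p, p.1 - x * p.2 \in diffset B (ldilate x B)}.
    by move=> _ /allpairsP[[b b'] [/= bB b'B ->]]; rewrite mem_diffset// in_imfset.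
  apply: leq_trans (sqr_size_leq_collisions (fset_uniq _) h) _.
  by rewrite leq_mul2r leS// orbT.
have leE2 : (\sum_(x <- S) \sum_(p <- s) \sum_(p' <- s) E x p p' <=
    \sum_(p <- s) \sum_(p' <- s) ((p' == p) * #|` S| + 1))%N.
  rewrite exchange_big /=; apply: leq_sum => p _.
  rewrite exchange_big /=; apply: leq_sum => p' _.
  case: eqP => [_|/eqP ne].
    rewrite mul1n card_fset_sum1 (leq_trans _ (leq_addr _ _))//.
    by apply: leq_sum => x _; apply: leq_b1.
  rewrite mul0n; apply: (@sum_eq_le1 _ _ ((p.1 - p'.1) / (p.2 - p'.2))) => [|x]; first exact: fset_uniq.
  rewrite /E => /eqP e.
  have e' : p.1 - p'.1 = x * (p.2 - p'.2).
    by rewrite mulrBr -(subrK (x * p.2) p.1) e addrAC (addrC p'.1) addrK addrC.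
  rewrite e' mulrK//; apply: divD; apply: contraNneq ne => /eqP.
  rewrite subr_eq0 => /eqP e2; rewrite e2 in e; move/addIr: e => e1.
  by rewrite [p]surjective_pairing [p']surjective_pairing e1 e2.
move: (leq_trans leE (leq_mul (leqnn _) leE2)).
have -> : (\sum_(p <- s) \sum_(p' <- s) ((p' == p) * #|` S| + 1) =
    size s * #|` S| + size s * size s)%N.
  rewrite big_seq (eq_bigr (fun=> #|` S| + size s)%N).
    by rewrite -big_seq big_const_seq count_predT iter_addn_0 mulnC mulnDr.
  move=> p ps; rewrite big_split /= -big_distrl /= sum1_size.
  by rewrite -big_mkcond /= sum1_count count_uniq_mem// ps mul1n.
rewrite big_const_seq count_predT iter_addn_0 ss.
move: (#|` B|) (#|` S|) leT B_gt0 => m n leT m_gt0 le.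
have {}le : (n * m <= T * n + T * (m * m))%N.
  have m3 : (0 < m * m * m)%N by rewrite !muln_gt0 m_gt0.
  by rewrite -(leq_pmul2l m3); move: le; rewrite -mulnn; lia.
rewrite -(leq_pmul2r m_gt0).
have := leq_mul leT (leqnn n); lia.
Qed.

Lemma subring_of_controlled B M :
  0 \notin B -> B != fset0 -> (2 * M ^ 108 <= #|` B|)%N ->
  {in B &, forall b b', #|` diffset (ldilate b B) (ldilate b' B)| <= M * #|` B|}%N ->
  {in B &, forall b b', #|` diffset (rdilate B b) (rdilate B b')| <= M * #|` B|}%N ->
  exists S a, [/\ finite_subring S, (#|` S| <= 2 * M ^ 12 * #|` B|)%N, a \in B,
    ldilate a S = rdilate S a & B `<=` ldilate a S].
Proof.
move=> B0 Bn0 ltB leL leR.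
have B_gt0 : (0 < #|` B|)%N by rewrite cardfs_gt0.
have nz b : b \in B -> b != 0 by move=> bB; apply: contraNneq B0 => <-.
have [a aB] := fset0Pn _ Bn0; have a0 := nz _ aB; have aU := divD a0.
have M_gt0 : (0 < M)%N.
  have := leL _ _ aB aB; case: (M) => //; rewrite mul0n leqn0 cardfs_eq0.
  move=> /eqP e; have : a * a - a * a \in diffset (ldilate a B) (ldilate a B).
    by rewrite mem_diffset// in_imfset.
  by rewrite e.
have MX i j : (i <= j)%N -> (M ^ i <= M ^ j)%N by apply: leq_pexp2l.
have ltT i : (i <= 108)%N -> (M ^ i * #|` B| < #|` B| * #|` B|)%N.
  move=> i108; rewrite ltn_pmul2r// (leq_ltn_trans (MX _ _ i108))//.
  by apply: leq_trans ltB; rewrite ltn_Pmull// expn_gt0 M_gt0.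
set V := diffset B B.
have ctrlL := card_dilates_control Bn0 (fun b bB => divr_mulI (nz _ bB))
  (fun b x y => mulrBr b x y) (fun b x y => mulrBl b x y) leL.
have ctrlR := @card_dilates_control _ B (fun b x => x * b) M Bn0
  (fun b bB => divr_mulIr (nz _ bB)) (fun b x y => mulrBl b x y)
  (fun b x y => mulrBr b x y) leR.
(* u = 0 is harmless: 0^-1 = 0 only contributes the element 0. *)
pose S := [fset u^-1 * v | u in V, v in V].
have SP x : x \in S -> exists u v, [/\ u \in V, v \in V & x = u^-1 * v].
  by move=> /imfset2P[u uV [v vV ->]]; exists u, v.
have PS u v : u \in V -> v \in V -> u^-1 * v \in S.
  by move=> uV vV; apply/imfset2P; exists u => //; exists v.
have leL0 : (#|` diffset B (ldilate 0 B)| <= #|` B|)%N.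
  rewrite -[leqRHS](card_sumset1 B 0); apply: fsubset_leq_card.
  apply/fsubsetP => _ /diffsetP[b [_ [bB /imfsetP[c /= _ ->] ->]]].
  by rewrite mul0r subr0 -[b]addr0 mem_sumset// inE.
have SL x : x \in S -> (#|` diffset B (ldilate x B)| <= M ^ 12 * #|` B|)%N.
  move=> /SP[u [v [uV vV ->]]]; have [->|u0] := eqVneq u 0.
    rewrite invr_out ?unitr0// mul0r (leq_trans leL0)//.
    by rewrite leq_pmull// expn_gt0 M_gt0.
  rewrite -(card_diffset_image _ _ (divr_mulI u0) (fun x y => mulrBr u x y)).
  apply: leq_trans (ctrlL _ _ uV vV); apply/eq_leq; congr (#|` diffset _ _|).
  apply/fsetP => y; apply/imfsetP/imfsetP => /=.
    by move=> [_ /imfsetP[z /= zB ->] ->]; exists z; rewrite // mulrA mulVKr// divD.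
  move=> [z zB ->]; exists (u^-1 * v * z); first exact: in_imfset.
  by rewrite mulrA mulVKr// divD.
have LS x i : (i <= 108)%N -> (#|` diffset B (ldilate x B)| <= M ^ i * #|` B|)%N ->
    exists u v, [/\ u \in V, v \in V, u != 0 & x = v / u].
  move=> i108 /leq_ltn_trans/(_ (ltT _ i108))/diffset_collision.
  move=> [b1 [b2 [b3 [b4 [b13 b24 ne e]]]]]; exists (b2 - b4), (b1 - b3).
  have ne0 : b2 - b4 != 0 by rewrite subr_eq0.
  by split=> //; rewrite e -mulrBr mulrK// divD.
have QS u v : u \in V -> v \in V -> u != 0 -> v / u \in S.
  move=> uV vV u0.
  have : (#|` diffset B (rdilate B (v / u))| <= M ^ 12 * #|` B|)%N.
    rewrite -(card_diffset_image _ _ (divr_mulIr u0) (fun x y => mulrBl u x y)).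
    apply: leq_trans (ctrlR _ _ uV vV); apply/eq_leq; congr (#|` diffset _ _|).
    apply/fsetP => y; apply/imfsetP/imfsetP => /=.
      by move=> [_ /imfsetP[z /= zB ->] ->]; exists z; rewrite // mulrA mulrVK// divD.
    move=> [z zB ->]; exists (z * (v / u)); first exact: in_imfset.
    by rewrite mulrA mulrVK// divD.
  move=> /leq_ltn_trans/(_ (ltT 12 isT))/diffset_collision.
  move=> [b1 [b2 [b3 [b4 [b13 b24 ne e]]]]].
  have ne0 : b2 - b4 != 0 by rewrite subr_eq0.
  have -> : v / u = (b2 - b4)^-1 * (b1 - b3) by rewrite e -mulrBl mulKr// divD.
  exact: PS.
have LSS x i : (i <= 108)%N -> (#|` diffset B (ldilate x B)| <= M ^ i * #|` B|)%N ->
    x \in S.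
  by move=> i108 /(LS _ _ i108)[u [v [uV vV u0 ->]]]; apply: QS.
have S0 : 0 \in S by apply: (LSS _ 0%N) => //; rewrite mul1n.
have leB : (#|` diffset B B| <= M * #|` B|)%N.
  have := leL _ _ aB aB.
  by rewrite (card_diffset_image _ _ (divr_mulI a0) (fun x y => mulrBr a x y)).
have SB x y : x \in S -> y \in S -> x - y \in S.
  move=> xS yS; apply: (LSS _ 108%N) => //.
  have leB12 : (#|` diffset B B| <= M ^ 12 * #|` B|)%N.
    by rewrite (leq_trans leB)// leq_mul2r (MX 1%N)// orbT.
  have cov z : z \in S -> coverable (M ^ 12) B 1 (ldilate z B).
    by move=> /SL zS; apply: coverable1 => //; rewrite card_diffsetC.
  have covxy := coverableB (coverable1 Bn0 leB12) (coverableB (cov _ xS) (cov _ yS)).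
  rewrite (_ : 108 = 12 * (3 * 3))%N// expnM; apply: card_coverable Bn0 leB12 _.
  apply: coverableS covxy; apply: diffsetS => //.
  by apply/fsubsetP => _ /imfsetP[z /= zB ->]; rewrite mulrBl mem_diffset ?in_imfset.
have SM x y : x \in S -> y \in S -> x * y \in S.
  move=> xS yS; have [->|x0] := eqVneq x 0; first by rewrite mul0r.
  apply: (LSS _ 24%N) => //; rewrite -(leq_pmul2r B_gt0).
  have cx : #|` ldilate x B| = #|` B| by rewrite card_imfset//; apply: divr_mulI.
  rewrite -{1}cx (leq_trans (ruzsa_triangle _ _ _))//.
  have -> : ldilate (x * y) B = ldilate x (ldilate y B).
    apply/fsetP => z; apply/imfsetP/imfsetP => /=.
      move=> [w wB ->]; exists (y * w); rewrite ?mulrA// in_imfset//.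
    by move=> [_ /imfsetP[w /= wB ->] ->]; exists w; rewrite ?mulrA.
  rewrite (card_diffset_image _ _ (divr_mulI x0) (fun u v => mulrBr x u v)).
  apply: leq_trans (leq_mul (SL _ xS) (SL _ yS)) _.
  by rewrite mulnACA -expnD mulnA.
have BS b : b \in B -> a^-1 * b \in S.
  move=> bB; apply: (LSS _ 1%N) => //.
  rewrite -(card_diffset_image _ _ (divr_mulI a0) (fun x y => mulrBr a x y)).
  apply: leq_trans (leL _ _ aB bB); apply/eq_leq; congr (#|` diffset _ _|).
  apply/fsetP => y; apply/imfsetP/imfsetP => /=.
    by move=> [_ /imfsetP[z /= zB ->] ->]; exists z; rewrite // mulrA mulVKr.
  move=> [z zB ->]; exists (a^-1 * b * z); first exact: in_imfset.
  by rewrite mulrA mulVKr.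
have SV x : x \in S -> x^-1 \in S.
  move=> /SP[u [v [uV vV ->]]]; have [->|u0] := eqVneq u 0.
    by rewrite [0^-1]invr_out ?unitr0// mul0r invr_out ?unitr0.
  have [->|v0] := eqVneq v 0; first by rewrite mulr0 invr_out ?unitr0.
  by rewrite invrM ?unitrV ?divD// invrK PS.
exists S, a; split=> //.
- apply: card_expanders => //; apply: leq_trans ltB.
  by rewrite leq_mul2l MX.
- apply/eqP; rewrite eq_sym eqEfcard.
  rewrite !card_imfset ?leqnn ?andbT /=; try exact: divr_mulI; try exact: divr_mulIr.
  apply/fsubsetP => _ /imfsetP[x /= /SL xS ->].
  have VS v : v \in V -> a^-1 * v \in S.
    by move=> /diffsetP[b [b' [bB b'B ->]]]; rewrite mulrBr SB ?BS.
  have [u [v [uV vV u0 ->]]] := LS x 12%N isT xS.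
  have -> : v / u * a = a * ((a^-1 * v) * (a^-1 * u)^-1).
    by rewrite invrM ?unitrV ?divD// invrK !mulrA mulrV// mul1r.
  by rewrite in_imfset//= SM ?SV ?VS.
- apply/fsubsetP => b bB; apply/imfsetP; exists (a^-1 * b); first exact: BS.
  by rewrite mulVKr.
Qed.

End DivisionRing.
Lemma ldilateS (D : nzRingType) (r : D) (A B : {fset D}) :
  A `<=` B -> ldilate r A `<=` ldilate r B.
Proof. by move=> /fsubsetP AB; apply: subset_imfset => x /AB. Qed.

Lemma rdilateS (D : nzRingType) (r : D) (A B : {fset D}) :
  A `<=` B -> rdilate A r `<=` rdilate B r.
Proof. by move=> /fsubsetP AB; apply: subset_imfset => x /AB. Qed.

Lemma two_sided_controlled_subset (D : unitRingType) (A : {fset D}) (N : nat) :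
  division_ring D -> 0 \notin A -> A != fset0 ->
  (#|` sumset A A| <= N * #|` A|)%N -> (#|` prodset A A| <= N * #|` A|)%N ->
  exists B : {fset D}, let M := (1024 * N ^ 28)%N in
    [/\ B `<=` A, (#|` A| <= M * #|` B|)%N, (#|` diffset A B| <= M * #|` B|)%N,
    {in B &, forall b b', #|` diffset (ldilate b B) (ldilate b' B)| <= M * #|` B|}%N &
    {in B &, forall b b', #|` diffset (rdilate B b) (rdilate B b')| <= M * #|` B|}%N].
Proof.
move=> divD A0 An0 leS leM; have A_gt0 : (0 < #|` A|)%N by rewrite cardfs_gt0.
have N_gt0 : (0 < N)%N.
  have := leq_trans (leq_card_sumsetr A An0) leS.
  by case: (N) => //; rewrite mul0n leqNgt A_gt0.
have NX i j : (i <= j)%N -> (N ^ i <= N ^ j)%N by apply: leq_pexp2l.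
have nz a : a \in A -> a != 0 by move=> aA; apply: contraNneq A0 => <-.
have leD : (#|` diffset A A| <= N ^ 2 * #|` A|)%N.
  rewrite -(leq_pmul2r A_gt0) -{1}(card_oppset A) (leq_trans (ruzsa_triangle _ _ _))//.
  rewrite /diffset -oppset_sumset oppsetK card_oppset.
  by rewrite (leq_trans (leq_mul leS leS))// mulnACA mulnn mulnA.
have [B1 [B1A leB1 ctrlL]] := controlled_subset (f := *%R) (N := N ^ 2) An0
  (fun a aA => divr_mulI divD (nz _ aA)) (fun a x y => mulrBr a x y)
  (leq_trans leM (leq_mul (NX 1%N 2%N isT) (leqnn _))) leD.
have B1n0 : B1 != fset0.
  by rewrite -cardfs_gt0; case: #|` B1| leB1 => //; rewrite muln0 leqNgt A_gt0.
have leM1 : (#|` [fset (b * a)%R | a in B1, b in B1]| <= 2 * N ^ 4 * #|` B1|)%N.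
  apply: (@leq_trans #|` prodset A A|).
    apply: fsubset_leq_card; apply/fsubsetP => _ /imfset2P[a aB [b bB ->]].
    by rewrite in_imfset2 ?(fsubsetP B1A).
  apply: leq_trans leM (leq_trans (leq_mul (leqnn _) leB1) _).
  by rewrite mulnA mulnCA -expnS leq_mul// leq_mul// NX.
have leD1 : (#|` diffset B1 B1| <= 2 * N ^ 4 * #|` B1|)%N.
  apply: leq_trans (fsubset_leq_card (diffsetS B1A B1A)) _.
  apply: leq_trans leD (leq_trans (leq_mul (leqnn _) leB1) _).
  by rewrite mulnA mulnCA -expnD.
have [B [BB1 leB ctrlR]] := controlled_subset (f := fun a x => x * a) B1n0
  (fun a aA => divr_mulIr divD (nz _ (fsubsetP B1A _ aA)))
  (fun a x y => mulrBl a x y) leM1 leD1.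
have BA := fsubset_trans BB1 B1A.
have leAB : (#|` A| <= 8 * N ^ 6 * #|` B|)%N.
  apply: leq_trans leB1 (leq_trans (leq_mul (leqnn _) leB) _).
  by rewrite (expnD N 2 4) !mulnA leq_mul//; apply/eq_leq; lia.
have NM c i : (c <= 1024)%N -> (i <= 28)%N -> (c * N ^ i <= 1024 * N ^ 28)%N.
  by move=> c_le i_le; rewrite leq_mul ?NX.
exists B; split=> //.
- by rewrite (leq_trans leAB)// leq_mul2r NM ?orbT.
- apply: leq_trans (fsubset_leq_card (diffsetS (fsubset_refl A) BA)) _.
  apply: leq_trans leD (leq_trans (leq_mul (leqnn _) leAB) _).
  by rewrite mulnA mulnCA -expnD leq_mul2r NM ?orbT.
- move=> b b' bB b'B.
  have [bB1 b'B1] := (fsubsetP BB1 _ bB, fsubsetP BB1 _ b'B).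
  apply: leq_trans (fsubset_leq_card (diffsetS _ _)) (leq_trans (ctrlL _ _ bB1 b'B1) _).
  - exact: ldilateS.
  - exact: ldilateS.
  - apply: leq_trans (leq_mul (leqnn _) leAB) _.
    rewrite mulnA leq_mul2r; apply/orP; right.
    by rewrite expnMn -!expnM mulnACA -expnD (NM 32%N 18%N).
- move=> b b' bB b'B.
  apply: leq_trans (fsubset_leq_card (diffsetS _ _)) (leq_trans (ctrlR _ _ bB b'B) _).
  - exact: rdilateS.
  - exact: rdilateS.
  - apply: leq_trans (leq_mul (leqnn _) leB) _.
    rewrite mulnA leq_mul2r; apply/orP; right.
    rewrite (expnM N 4 7); move: (N ^ 4)%N => n.
    by apply/eq_leq; rewrite !expnS !expn0; lia.
Qed.

Lemma sum_product_nat (D : unitRingType) (A : {fset D}) (N : nat) :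
  division_ring D -> 0 \notin A -> A != fset0 ->
  (#|` sumset A A| <= N * #|` A|)%N -> (#|` prodset A A| <= N * #|` A|)%N ->
  exists (S X : {fset D}) (a : D), let M := (1024 * N ^ 28)%N in
    [/\ finite_subring S, (#|` S| <= 2 * M ^ 12 * #|` A|)%N,
      a \in A /\ ldilate a S = rdilate S a,
      (#|` X| <= 2 * M ^ 109)%N & A `<=` sumset (ldilate a S) X].
Proof.
move=> divD A0 An0 leS leP.
have [B [BA leAB leDAB ctrlL ctrlR]] := two_sided_controlled_subset divD A0 An0 leS leP.
move: (1024 * N ^ 28)%N leAB leDAB ctrlL ctrlR => M leAB leDAB ctrlL ctrlR.
have A_gt0 : (0 < #|` A|)%N by rewrite cardfs_gt0.
have [M_gt0 B_gt0] : (0 < M)%N /\ (0 < #|` B|)%N.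
  by apply/andP; rewrite -muln_gt0 (leq_trans A_gt0).
have Bn0 : B != fset0 by rewrite -cardfs_gt0.
have [leB|ltB] := leqP (2 * M ^ 108) #|` B|.
  have B0 : 0 \notin B by apply: contra A0; apply: (fsubsetP BA).
  have [S [a [Ssub leSB aB aS BaS]]] := subring_of_controlled divD B0 Bn0 leB ctrlL ctrlR.
  have [X [_ cX AX]] := ruzsa_covering Bn0 leDAB.
  exists S, X, a; split=> //.
  - by rewrite (leq_trans leSB)// leq_mul2l fsubset_leq_card ?orbT.
  - by split=> //; apply: (fsubsetP BA).
  - rewrite (leq_trans cX)// expnS mulnCA leq_pmulr//.
    by rewrite muln_gt0 expn_gt0 M_gt0.
  - rewrite sumsetC (fsubset_trans AX)// sumsetS//.
    apply/fsubsetP => _ /diffsetP[b [b' [bB b'B ->]]].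
    have /imfsetP[x /= xS ->] := fsubsetP BaS _ bB.
    have /imfsetP[y /= yS ->] := fsubsetP BaS _ b'B; rewrite -mulrBr.
    by rewrite in_imfset//; apply: Ssub.1.2.
have [a aA] := fset0Pn _ An0.
exists [fset 0], A, a; split.
- by split; [split=> [|x y]|move=> x y]; rewrite ?inE => // /eqP-> /eqP->;
    rewrite ?subrr ?mulr0.
- rewrite cardfs1 muln_gt0 A_gt0 muln_gt0 expn_gt0 M_gt0//.
- split=> //; apply/fsetP => x.
  by apply/imfsetP/imfsetP => -[_ /fset1P -> ->]; exists 0; rewrite ?inE ?mul0r ?mulr0.
- rewrite (leq_trans leAB)// expnS mulnCA leq_mul2l (ltnW ltB) orbT//.
- apply/fsubsetP => x xA; rewrite -[x]add0r mem_sumset//.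
  by apply/imfsetP; exists 0; rewrite ?inE ?mulr0.
Qed.

Theorem theorem5p2 :
  exists C1 c1 C2 c2 : nat,
  forall (R : realType) (D : unitRingType) (A : {fset D}) (K : R),
    division_ring D ->
    A != fset0 ->
    A != [fset 0] ->
    1 <= K ->
    #|` sumset A A|%:R <= K * #|` A|%:R ->
    #|` prodset A A|%:R <= K * #|` A|%:R ->
    exists (S : {fset D}) (a : D),
      [/\ finite_subring S,
          #|` S|%:R <= C1%:R * K ^+ c1 * #|` A|%:R,
          a \in A /\ a \is a GRing.unit,
          ldilate a S = rdilate S a &
          exists X : {fset D},
            [/\ X != fset0,
                #|` X|%:R <= C2%:R * K ^+ c2 &
                A `<=` sumset (ldilate a S) X]].
Proof.
have [c cE] : exists c, c = (1024 * 3 ^ 28)%N by exists (1024 * 3 ^ 28)%N.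
exists (2 * c ^ 12)%N, (28 * 12)%N, (3 * c ^ 109)%N, (28 * 109)%N.
move=> R D A K divD An0 An1 K1 leS leP.
have K0 : 0 <= K by rewrite (le_trans ler01).
pose A' := A `\ 0; have A'A : A' `<=` A by apply: fsubsetDl.
have A'0 : 0 \notin A' by rewrite !inE eqxx.
have A'n0 : A' != fset0.
  apply: contraNneq An1 => /eqP; rewrite fsetD_eq0 => sub; rewrite eqEfsubset sub.
  by have [x xA] := fset0Pn _ An0; have /fset1P <- := fsubsetP sub _ xA; rewrite fsub1set.
have leA : (#|` A| <= 2 * #|` A'|)%N.
  rewrite (cardfsD1 0) -/A' mul2n -addnn leq_add2r (leq_trans (leq_b1 _))//.
  by rewrite cardfs_gt0.
pose N := (Num.trunc (2 * K)).+1.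
have leN : N%:R <= 3 * K.
  have /andP[h _] := truncn_itv (mulr_ge0 (ler0n R 2) K0).
  have -> : 3 * K = 2 * K + K by rewrite -{3}[K]mul1r -mulrDl natr1.
  by rewrite /N -natr1 lerD.
have doubling n m : n%:R <= K * #|` A|%:R -> (m <= n)%N -> (m <= N * #|` A'|)%N.
  move=> le lemn; rewrite -(ler_nat R) natrM.
  have ltN : 2 * K <= N%:R by rewrite ltW// truncnS_gt.
  apply: (@le_trans _ _ (2 * K * #|` A'|%:R)); last by rewrite ler_wpM2r.
  rewrite (le_trans _ (le_trans le _)) ?ler_nat//.
  by rewrite (mulrC 2) -mulrA ler_wpM2l// -natrM ler_nat.
have subS : (#|` sumset A' A'| <= #|` sumset A A|)%N.
  by rewrite fsubset_leq_card// sumsetS.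
have subP : (#|` prodset A' A'| <= #|` prodset A A|)%N.
  apply: fsubset_leq_card; apply/fsubsetP => _ /imfset2P[x xA' [y yA' ->]].
  by rewrite in_imfset2 ?(fsubsetP A'A).
have [S [X [a [Ssub cS [aA' aS] cX A'X]]]] :=
  sum_product_nat divD A'0 A'n0 (doubling _ _ leS subS) (doubling _ _ leP subP).
have leM k : (1024 * N ^ 28)%N%:R ^+ k <= (c ^ k)%N%:R * K ^+ (28 * k).
  rewrite (natrX R c k) exprM -exprMn lerXn2r ?nnegrE ?mulr_ge0 ?exprn_ge0//.
  rewrite cE (natrM R 1024 (N ^ 28)) (natrM R 1024 (3 ^ 28)) (natrX R N) (natrX R 3).
  by rewrite -mulrA -exprMn ler_wpM2l// lerXn2r ?nnegrE// mulr_ge0.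
have : (0 < 1024 * N ^ 28)%N by rewrite muln_gt0 expn_gt0.
move: (1024 * N ^ 28)%N cS cX leM => M cS cX leM M_gt0.
have aA := fsubsetP A'A _ aA'.
have a0 : a != 0 by apply: contraNneq A'0 => <-.
exists S, a; split=> //.
- apply: (@le_trans _ _ ((2 * M ^ 12 * #|` A'|)%:R)).
    by rewrite ler_nat.
  have := leM 12%N; rewrite -natrX (natrM R 2 (c ^ 12)).
  move: (K ^+ (28 * 12)) (c ^ 12)%N (M ^ 12)%N => x y z lezx.
  rewrite natrM natrM -!mulrA ler_wpM2l// mulrA ler_pM//.
  by rewrite ler_nat fsubset_leq_card.
- by split; last exact: divD.
exists (0 |` X); split.
- by apply/fset0Pn; exists 0; rewrite fset1U1.
- apply: (@le_trans _ _ ((3 * M ^ 109)%:R)).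
    rewrite ler_nat cardfsU1 (leq_trans (leq_add (leq_b1 _) cX))//.
    by rewrite (mulnDl 1 2) leq_add// mul1n expn_gt0 M_gt0.
  have := leM 109%N; rewrite -natrX (natrM R 3 (c ^ 109)) (natrM R 3 (M ^ 109)).
  move: (K ^+ (28 * 109)) (c ^ 109)%N (M ^ 109)%N => x y z lezx.
  by rewrite -mulrA ler_wpM2l.
- apply/fsubsetP => x xA; have [->|x0] := eqVneq x 0.
    rewrite -{1}[0]addr0 mem_sumset ?fset1U1//.
    by apply/imfsetP; exists 0; rewrite ?mulr0//; apply: Ssub.1.1.
  have xA' : x \in A' by rewrite !inE x0.
  apply: (fsubsetP _ _ (fsubsetP A'X _ xA')).
  by apply: sumsetS; rewrite // fsubsetUr.
Qed.
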